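(* Suppose that $A$ is a Barker sequence of odd length $n$, where $n>1$, and that $s_1>1$. Then $n\le s_1+s_e+1$.
   Context: A binary sequence $A$ of length $n>1$ is an element of $\{-1,1\}^n$; its $k$-th entry is written $A(k)$, for $1\le k\le n$. For an integer $u$ with $0\le u<n$, the aperiodic autocorrelation of $A$ at shift $u$ is $C(u)=\sum_{k=1}^{n-u}A(k)A(k+u)$. A Barker sequence of length $n$ is a binary sequence $A$ of length $n>1$ such that $|C(u)|\le 1$ for every $u$ with $1\le u<n$. The runs of $A$ are its subsequences of consecutive entries of maximal length consisting of equal entries. A Barker sequence $A$ of odd length $n=2m-1$ has exactly $m$ runs. Associate with $A$ the unique integers $s_0,s_1,\dots,s_m$ satisfying $0=s_0<s_1<\dots<s_{m-1}<s_m=n$ and $A(s_j+1)=A(s_j+2)=\cdots=A(s_{j+1})=(-1)^jA(1)$ for all $j\in\{0,1,\dots,m-1\}$ (so $s_j$ is the sum of the lengths of the first $j$ runs of $A$). If $s_1>1$, then $s_1$ does not divide all of $s_1,\dots,s_m$, and $e$ denotes the smallest $j\in\{1,\dots,m\}$ such that $s_1\nmid s_j$. *)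

(* Defs.v *)
From mathcomp Require Import all_boot all_order all_algebra zify ring.
Set Implicit Arguments. Unset Strict Implicit. Unset Printing Implicit Defensive.
Import Order.TTheory GRing.Theory Num.Theory.
Local Open Scope ring_scope.

(* Indices are 1-based: [entry A k] is A(k) for 1 <= k <= n; the values at
   k = 0 and k > n are junk and never used. *)
Definition entry (n : nat) (A : n.-tuple int) (k : nat) : int :=
  nth 0 A k.-1.

Definition binary (n : nat) (A : n.-tuple int) : Prop :=
  forall k : nat, (1 <= k <= n)%N -> entry A k = -1 \/ entry A k = 1.

Definition autocorr (n : nat) (A : n.-tuple int) (u : nat) : int :=
  \sum_(1 <= k < (n - u).+1) entry A k * entry A (k + u).

Definition barker (n : nat) (A : n.-tuple int) : Prop :=
  [/\ (1 < n)%N, binary A &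
      forall u : nat, (1 <= u < n)%N -> `|autocorr A u| <= 1].

(* [s j] is the sum of the lengths of the first [j] runs of [A], and [m] is the
   number of runs; only the values [s 0], ..., [s m] are meaningful. *)
Definition run_ends (n : nat) (A : n.-tuple int) (m : nat) (s : nat -> nat)
    : Prop :=
  [/\ s 0%N = 0%N, s m = n,
      forall j : nat, (j < m)%N -> (s j < s j.+1)%N &
      forall j k : nat, (j < m)%N -> (s j < k <= s j.+1)%N ->
        entry A k = (-1) ^+ j * entry A 1].

Definition first_nondiv (m : nat) (s : nat -> nat) (e : nat) : Prop :=
  [/\ (1 <= e <= m)%N, ~~ (s 1 %| s e)%N &
      forall j : nat, (1 <= j < e)%N -> (s 1 %| s j)%N].

(* The three facts below show that [s] and [e] are well defined for a Barker
   sequence of odd length n = 2m - 1. *)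

Lemma run_ends_uniq (n : nat) (A : n.-tuple int) (m : nat) (s t : nat -> nat) :
  binary A -> run_ends A m s -> run_ends A m t ->
  forall j : nat, (j <= m)%N -> s j = t j.
Proof.
move=> bA.
have wlg s' t' : run_ends A m s' -> run_ends A m t' ->
    forall j, (j < m)%N -> s' j = t' j -> (t' j.+1 <= s' j.+1)%N.
  move=> [s0 sm si sv] [t0 tm ti tv] j jm e; rewrite leqNgt; apply/negP => lt.
  have tle k : (k <= m)%N -> (t' (m - k) <= n)%N.
    elim: k => [|k IH] km; first by rewrite subn0 tm.
    have h := ti (m - k.+1)%N ltac:(lia).
    have E : (m - k.+1).+1 = (m - k)%N by lia.
    rewrite E in h; have := IH ltac:(lia); lia.
  have tj := tle (m - j.+1)%N ltac:(lia); rewrite subKn // in tj.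
  have jm1 : (j.+1 < m)%N.
    rewrite ltn_neqAle jm andbT; apply/eqP => E; move: lt; rewrite E sm.
    by rewrite E in tj; lia.
  have h1 := sv j.+1 (s' j.+1).+1 jm1.
  have h2 := tv j (s' j.+1).+1 jm.
  have i1 := si _ jm1; have i0 := si _ jm.
  have {}h1 := h1 ltac:(lia); have {}h2 := h2 ltac:(lia).
  have := bA (s' j.+1).+1 ltac:(lia).
  rewrite exprS in h1; lia.
move=> hs ht; elim=> [|j IH] jm; first by case: hs ht => -> _ _ _ [-> _ _ _].
have E := IH (ltnW jm).
by apply/eqP; rewrite eqn_leq (wlg t s) // (wlg s t).
Qed.

Lemma run_ends_ex (n m : nat) (A : n.-tuple int) :
  barker A -> n = (2 * m - 1)%N -> exists s : nat -> nat, run_ends A m s.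
Proof.
move=> [n1 bA cA] nm.
have main p : (1 <= p <= n)%N -> exists (q : nat) (s : nat -> nat),
   [/\ [/\ (0 < q)%N, s 0%N = 0%N, s q = p &
       forall j : nat, (j < q)%N -> (s j < s j.+1)%N],
       (forall j k : nat, (j < q)%N -> (s j < k <= s j.+1)%N ->
         entry A k = (-1) ^+ j * entry A 1) &
       \sum_(1 <= k < p) entry A k * entry A (k + 1) = p%:Z + 1 - 2 * q%:Z].
  elim: p => // p IH hp.
  have [->|p0] := posnP p.
    exists 1%N, id; split; first by split=> //; case.
    - by move=> [|j] [|[|k]] //; rewrite expr0 mul1r.
    - by rewrite big_geq.
  have [q [s [[q0 s0 sq si] sv c]]] := IH ltac:(lia).
  have ep : entry A p = (-1) ^+ q.-1 * entry A 1.
    apply: sv; first lia.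
    have := si q.-1 ltac:(lia); rewrite prednK // sq; lia.
  have bp := bA p ltac:(lia); have bp1 := bA p.+1 ltac:(lia).
  have [E|E] := eqVneq (entry A p.+1) (entry A p).
    exists q, (fun j => if (j == q)%N then p.+1 else s j); split.
    - rewrite eqxx ifN ?s0; last by lia.
      split=> // j jq; rewrite (_ : (j == q) = false); last by lia.
      case: eqVneq => [e|_]; last exact: si.
      by have := si _ jq; rewrite e sq; lia.
    - move=> j k jq; rewrite (_ : (j == q) = false); last by lia.
      case: eqVneq => [e|_]; last exact: sv.
      have [->|kp] := eqVneq k p.+1.
        by rewrite E ep; have -> : j = q.-1 by lia.
      by move=> h; apply: sv => //; rewrite e sq; lia.
    - rewrite big_nat_recr //= c addn1 E; case: bp => ->; lia.
  exists q.+1, (fun j => if (j == q.+1)%N then p.+1 else s j); split.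
  - rewrite eqxx /= s0; split=> // j jq.
    rewrite (_ : (j == q.+1) = false); last by lia.
    case: eqVneq => [e|ne]; last by apply: si; lia.
    by rewrite (_ : j = q) ?sq //; lia.
  - move=> j k jq; rewrite (_ : (j == q.+1) = false); last by lia.
    case: eqVneq => [e|ne]; last by apply: sv; lia.
    have -> : j = q by lia. rewrite sq => kp; have -> : k = p.+1 by lia.
    rewrite -(prednK q0) exprS -mulrA -ep.
    by case: bp bp1 E => -> [] ->.
  - rewrite big_nat_recr //= c addn1.
    by case: bp bp1 E => -> [] -> //; lia.
have [q [s [[q0 s0 sq si] sv c]]] := main n ltac:(lia).
have := cA 1%N ltac:(lia); rewrite /autocorr subn1 prednK; last lia.
rewrite c => h.
have E : q = m by lia.
by exists s; rewrite -E; split.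
Qed.

Lemma first_nondiv_ex (n m : nat) (A : n.-tuple int) (s : nat -> nat) :
  n = (2 * m - 1)%N -> run_ends A m s -> (1 < s 1)%N -> (0 < m)%N ->
  exists e : nat, first_nondiv m s e.
Proof.
move=> nm [s0 sm si _] s1 m0.
have ex : exists j, (1 <= j <= m)%N && ~~ (s 1 %| s j)%N.
  case: (boolP (has (fun j => ~~ (s 1 %| s j)%N) (iota 1 m))).
    by move=> /hasP[j]; rewrite mem_iota => h d; exists j; rewrite d andbT; lia.
  move=> /hasPn H.
  have dv j : (j <= m)%N -> (s 1 %| s j)%N.
    case: j => [|j] jm; first by rewrite s0 dvdn0.
    by have := H j.+1; rewrite negbK mem_iota; apply; lia.
  have ge j : (j <= m)%N -> (2 * j <= s j)%N.
    elim: j => // j IH jm.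
    have lt := si _ jm.
    have d : (s 1 %| s j.+1 - s j)%N by rewrite dvdn_sub ?dv //; lia.
    have := dvdn_leq _ d; rewrite subn_gt0 => /(_ lt).
    by have := IH ltac:(lia); lia.
  by have := ge m (leqnn m); rewrite sm; lia.
case: (ex_minnP ex) => e /andP[em d] mn; exists e; split=> // j je.
apply/negPn/negP => nd; have := mn j; rewrite nd andbT => h.
by have := h ltac:(lia); lia.
Qed.

(* Main.v *)
Require Import Defs.
From mathcomp Require Import all_boot all_order all_algebra.
From mathcomp Require Import zify ring.
Import Order.TTheory GRing.Theory Num.Theory.
Local Open Scope ring_scope.

(** Write a(x) for the generating series of A, indexed from 0, and
    b(x) = (1 - x) a(x) for the series of its jumps; let p = s 1, q = s e. The
    coefficients of b below degree n vanish off the run boundaries; the constant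
    one is a unit and the others are 0, 2 or -2.

    The autocorrelations of a binary sequence satisfy two congruences mod 4
    ([sub_autocorrS_mod4], [add_autocorr_mod4]). For a Barker sequence of odd
    length they force the autocorrelations at odd shifts to be 0 and those at
    nonzero even shifts to be a common sign ([barker_autocorr]), and then make A
    skew-symmetric ([barker_skew]). Skew-symmetry turns the autocorrelation at
    shift n - 1 - t, for even t, into the coefficient at t of a(x) a(-x). This
    product, an even series, therefore agrees with 1 / (1 - x^2) up to degree
    n - 2 ([barker_altconv]). Clearing the denominator gives b(x) b(-x) = 1 up
    to degree n - 2 ([barker_altconv_jump]).

    Suppose now that n > p + q + 1. Every boundary below q is a multiple of p.
    - At degree p, the coefficient of b(x) b(-x) has only its two end terms,
      because there is no boundary strictly between 0 and p. At degree q too,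
      because two multiples of p do not add up to q. For p or q even, these end
      terms would sum to the nonzero number 2 b_0 b_p or 2 b_0 b_q. Hence p and
      q are odd.
    - The degree p + q is then even, and there only the index pairs {0, p + q}
      and {p, q} survive: an index above q is paired with one below p, and two
      indices below q cannot both be multiples of p. This gives
      b_0 b_(p+q) = b_p b_q, which is impossible because the right-hand side is
      4 or -4 whereas |b_(p+q)| <= 2. *)

(** * Alternating self-convolutions *)

(** The coefficient at t of f(-x) f(x), where f also denotes the generating
    series of the sequence. *)
Definition altconv (f : nat -> int) (t : nat) : int :=
  \sum_(j < t.+1) (-1) ^+ j * f j * f (t - j)%N.

(** The coefficients of (1 - x) f(x). *)
Definition jump (f : nat -> int) (i : nat) : int :=
  if i is i'.+1 then f i - f i' else f 0%N.

(** Multiplying f(x) by 1 - x and f(-x) by 1 + x multiplies their product by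
    1 - x^2. *)
Lemma altconv_jump (f : nat -> int) (t : nat) :
  altconv (jump f) t.+2 = altconv f t.+2 - altconv f t.
Proof.
(* Truncating after degree t + 2 does not affect the coefficients involved. *)
pose P := \poly_(i < t.+3) ((-1) ^+ i * f i).
pose Q := \poly_(i < t.+3) f i.
have PQ k : (k < t.+3)%N -> (P * Q)`_k = altconv f k.
  move=> kt; rewrite coefM; apply: eq_bigr => j _.
  have hj := ltn_ord j.
  by rewrite !coef_poly !ifT //; lia.
have E : ((1 + 'X) * P) * ((1 - 'X) * Q) = P * Q - P * Q * 'X^2 by ring.
transitivity (P * Q - P * Q * 'X^2)`_t.+2; last first.
  by rewrite coefB coefMXn /= subn2 !PQ //; lia.
rewrite -E coefM.
apply: eq_bigr => j _; have hj := ltn_ord j.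
have -> : ((1 + 'X) * P)`_j = (-1) ^+ j * jump f j.
  rewrite mulrDl mul1r coefD coefXM !coef_poly.
  case: (nat_of_ord j) hj => [|i] hi /=; first by rewrite addr0.
  by rewrite hi ltnW // exprS; ring.
have -> // : ((1 - 'X) * Q)`_(t.+2 - j) = jump f (t.+2 - j)%N.
have : (t.+2 - j < t.+3)%N by lia.
rewrite mulrBl mul1r coefB coefXM !coef_poly.
case: (t.+2 - j)%N => [|i] hi /=; first by rewrite subr0.
by rewrite hi ltnW.
Qed.

Lemma altconv_even_ends (b : nat -> int) t : (0 < t)%N -> ~~ odd t ->
  (forall i, (0 < i < t)%N -> b i * b (t - i)%N = 0) ->
  altconv b t = 2 * b 0%N * b t.
Proof.
case: t => // t _ t_even H.
have sg : (-1) ^+ t.+1 = 1 :> int by rewrite -signr_odd (negbTE t_even).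
rewrite /altconv big_ord_recl big_ord_recr /=.
rewrite big1 => [|i _].
  rewrite subn0 subnn /bump /= add1n sg expr0; ring.
by rewrite -mulrA H ?mulr0 // /bump; have := ltn_ord i; lia.
Qed.

(** In even degree the terms at i and at p + q - i are equal; those at p and q
    come with a minus sign because p and q are odd. *)
Lemma altconv_even_ends_pair (b : nat -> int) p q :
  odd p -> odd q -> p != q ->
  (forall i, (0 < i < p + q)%N -> i != p -> i != q ->
    b i * b (p + q - i)%N = 0) ->
  altconv b (p + q) = 2 * (b 0%N * b (p + q)%N - b p * b q).
Proof.
move=> p_odd q_odd pq H; rewrite /altconv.
have even_pq : ~~ odd (p + q) by rewrite oddD p_odd q_odd.
have [p0 q0] := (odd_gt0 p_odd, odd_gt0 q_odd).
have lt_p : (p < (p + q).+1)%N by lia.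
have lt_q : (q < (p + q).+1)%N by lia.
rewrite (bigD1 ord0) // (bigD1 ord_max) -?val_eqE /=; last by lia.
rewrite (bigD1 (Ordinal lt_p)) -?val_eqE /=; last by lia.
rewrite (bigD1 (Ordinal lt_q)) -?val_eqE /=; last by lia.
rewrite big1 => [|i]; last first.
  rewrite -!val_eqE /= => hi; have := ltn_ord i => lt_i.
  by rewrite -mulrA H ?mulr0 //; lia.
rewrite subn0 subnn addnK addKn expr0.
by rewrite -!(signr_odd _ (_ + _)) -(signr_odd _ p) -(signr_odd _ q)
   (negbTE even_pq) p_odd q_odd expr0 expr1; ring.
Qed.

(** * Autocorrelations of binary sequences modulo 4 *)

Section Correlations.
Context {n : nat} {A : n.-tuple int}.
Hypothesis bA : binary A.

Lemma autocorr_parity u : (u <= n)%N -> (2 %| autocorr A u - (n - u)%N%:Z)%Z.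
Proof.
move=> un; rewrite /autocorr.
elim: {-2}(n - u)%N (leqnn (n - u)) => [|k IH] hk; first by rewrite big_geq.
rewrite big_nat_recr //=; have {IH} := IH ltac:(lia).
have h1 := bA k.+1 ltac:(lia); have h2 := bA (k.+1 + u)%N ltac:(lia).
move: (\sum_(1 <= i < k.+1) _) => S.
by case: h1 => ->; case: h2 => ->; lia.
Qed.

(** For signs x and y, xy = x + y - 1 mod 4. So mod 4 the autocorrelation at
    shift u is the sum of the first n - u entries and of the last n - u entries,
    minus n - u. From u to u + 1 it decreases by A(n - u) + A(u + 1) - 1, which
    is again the product of the two entries mod 4. *)
Lemma sub_autocorrS_mod4 u : (u < n)%N ->
  (4 %| autocorr A u - autocorr A u.+1 - entry A u.+1 * entry A (n - u))%Z.
Proof.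
move=> un; rewrite /autocorr.
have E : (n - u).+1 = (n - u.+1).+2 by lia.
rewrite E big_nat_recr //=.
have En : (n - u)%N = (n - u.+1).+1 by lia.
rewrite En.
have En' : ((n - u.+1).+1 + u)%N = n by lia.
rewrite {}En'.
(* The step from k to k + 1 changes the left-hand side by the product of
   A(k + 1) - 1 and A(k + u + 1) - A(k + u + 2), both of which are even. *)
have main k : (k <= n - u.+1)%N ->
  (4 %| \sum_(1 <= i < k.+1) entry A i * entry A (i + u)
      - \sum_(1 <= i < k.+1) entry A i * entry A (i + u.+1)
      - entry A u.+1 + entry A (k + u.+1))%Z.
  elim: k => [|k IH] hk; first by rewrite !big_geq // add0n subr0 sub0r addNr.
  rewrite !(big_nat_recr k.+1) //=; have {IH} := IH ltac:(lia).
  have h1 := bA k.+1 ltac:(lia); have h2 := bA (k + u.+1)%N ltac:(lia).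
  have h3 := bA (k.+1 + u.+1)%N ltac:(lia).
  rewrite addSnnS.
  move: (\sum_(1 <= i < k.+1) _) (\sum_(1 <= i < k.+1) _) => S S'.
  by case: h1 => ->; case: h2 => ->; case: h3 => ->; lia.
have := main _ (leqnn _).
have -> : (n - u.+1 + u.+1)%N = n by lia.
have h1 := bA (n - u.+1).+1 ltac:(lia); have h2 := bA u.+1 ltac:(lia).
have h3 := bA n ltac:(lia).
move: (\sum_(1 <= i < _.+1) _) (\sum_(1 <= i < _.+1) _) => S S'.
by case: h1 => ->; case: h2 => ->; case: h3 => ->; lia.
Qed.

Lemma autocorr0 : autocorr A 0 = n%:Z.
Proof.
rewrite /autocorr subn0 (eq_big_nat _ _ (F2 := fun=> 1)).
  by rewrite sumr_const_nat subn1 natz.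
by move=> k hk; rewrite addn0; case: (bA k ltac:(lia)) => ->.
Qed.

Lemma autocorr_size : autocorr A n = 0.
Proof. by rewrite /autocorr subnn big_geq. Qed.

(** By [sub_autocorrS_mod4], passing from u to u + 1 subtracts
    A(u + 1) A(n - u) from the first summand and adds it back to the second, so
    the sum keeps its value at u = 0. *)
Lemma add_autocorr_mod4 u : (u <= n)%N ->
  (4 %| autocorr A u + autocorr A (n - u) - n%:Z)%Z.
Proof.
elim: u => [|u IH] un.
  by rewrite subn0 autocorr0 autocorr_size addr0 subrr.
have := IH ltac:(lia); have := sub_autocorrS_mod4 u un.
have := sub_autocorrS_mod4 (n - u.+1)%N ltac:(lia).
have -> : (n - u.+1).+1 = (n - u)%N by lia.
have -> : (n - (n - u.+1))%N = u.+1 by lia.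
rewrite [entry A (n - u) * _]mulrC; lia.
Qed.

End Correlations.

(** * Barker sequences of odd length *)

Section OddBarker.
Context {n : nat} {A : n.-tuple int}.
Hypotheses (BA : barker A) (n_odd : odd n).

(** The sign congruent to the odd number n mod 4. *)
Let eps : int := if (n %% 4 == 1)%N then 1 else -1.

(** Of the shifts u and n - u one is odd. The autocorrelation there is even,
    hence 0, so the other one is congruent to n mod 4. *)
Lemma barker_autocorr u : (0 < u < n)%N ->
  autocorr A u = if odd u then 0 else eps.
Proof.
move=> un; have [_ bA cA] := BA.
have := cA u un; have := cA (n - u)%N ltac:(lia).
have := autocorr_parity bA u ltac:(lia).
have := autocorr_parity bA (n - u)%N ltac:(lia).
have := add_autocorr_mod4 bA u ltac:(lia).
rewrite /eps; case: ifP => ?; first by lia.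
by case: ifP; lia.
Qed.

(** The left-hand side is congruent mod 4 to the difference of two consecutive
    autocorrelations, and a sign is determined by its residue mod 4. *)
Lemma barker_skew u : (u < n)%N ->
  entry A u.+1 * entry A (n - u) = eps * (-1) ^+ u.
Proof.
move=> un; have [_ bA cA] := BA.
(* Mod 4, the formula of [barker_autocorr] extends to the shifts 0 and n. *)
have cmod v : (v <= n)%N -> (4 %| autocorr A v - (if odd v then 0 else eps))%Z.
  have [->|v0] := posnP v.
    by rewrite autocorr0 // /eps /=; case: ifP; lia.
  rewrite leq_eqVlt => /orP[/eqP ->|vn].
    by rewrite autocorr_size n_odd.
  by rewrite barker_autocorr ?v0 // subrr.
have := cmod u ltac:(lia); have := cmod u.+1 un.
have := sub_autocorrS_mod4 bA u un.
have h1 := bA u.+1 ltac:(lia); have h2 := bA (n - u)%N ltac:(lia).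
rewrite -signr_odd /= /eps.
by case: h1 => ->; case: h2 => ->; case: (n %% 4 == 1)%N;
  case: (odd u) => /=; lia.
Qed.

Let a (i : nat) : int := entry A i.+1.

(** By skew-symmetry each factor A(n - (t - i)) in the autocorrelation at shift
    n - 1 - t is, up to sign, A(t - i + 1). *)
Lemma barker_altconv t : ~~ odd t -> (t + 2 < n)%N -> altconv a t = 1.
Proof.
move=> t_even tn; have [_ bA _] := BA.
have eps2 : eps * eps = 1 by rewrite /eps; case: ifP.
have := barker_autocorr (n - t.+1) ltac:(lia).
rewrite ifN; last by lia.
rewrite /autocorr big_add1 /= big_mkord subKn; last by lia.
move=> h; apply: (mulfI (x := eps)).
  by rewrite /eps; case: ifP.
rewrite mulr1 -[RHS]h mulr_sumr; apply: eq_bigr => i _; have hi := ltn_ord i.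
have -> : (i.+1 + (n - t.+1))%N = (n - (t - i))%N by lia.
have := barker_skew (t - i)%N ltac:(lia); rewrite -/(a _) => sk.
have sq : a (t - i)%N * a (t - i)%N = 1.
  by rewrite /a; case: (bA (t - i).+1 ltac:(lia)) => ->.
have sg : (-1) ^+ (t - i) = (-1) ^+ i :> int.
  by rewrite -signr_odd oddB ?(negbTE t_even) /= ?signr_odd //; lia.
have -> : entry A (n - (t - i)) = eps * (-1) ^+ i * a (t - i)%N.
  by rewrite -sg -sk mulrAC sq mul1r.
rewrite -/(a i); ring.
Qed.

Lemma barker_altconv_jump t :
  ~~ odd t -> (0 < t)%N -> (t + 2 < n)%N -> altconv (jump a) t = 0.
Proof.
case: t => [|[|t]] //= t_even _ tn.
by rewrite altconv_jump !barker_altconv ?subrr //=; lia.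
Qed.

End OddBarker.

(** * Jumps and runs *)

Lemma run_ends_lt {n m : nat} {A : n.-tuple int} {s : nat -> nat} {i j : nat} :
  run_ends A m s -> (i < j <= m)%N -> (s i < s j)%N.
Proof.
move=> [_ _ si _]; elim: j => // j IH.
rewrite ltnS leq_eqVlt => /andP[/orP[/eqP ->|lt] jm]; first exact: si.
by apply: ltn_trans (si _ jm); apply: IH; lia.
Qed.

Lemma jump_neq0 {n m : nat} {A : n.-tuple int} {s : nat -> nat} {j : nat} :
  run_ends A m s -> binary A -> (0 < j < m)%N ->
  `|jump (fun i => entry A i.+1) (s j)| = 2.
Proof.
move=> RE bA; case: j => // j jm; have [s0 sm si sv] := RE.
have [i1 i2] := (si j ltac:(lia), si j.+1 ltac:(lia)).
have sn : (s j.+1 < n)%N.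
  by rewrite -sm; apply: (run_ends_lt RE); lia.
have := sv j.+1 (s j.+1).+1 ltac:(lia) ltac:(lia).
have := sv j (s j.+1) ltac:(lia) ltac:(lia).
case: (s j.+1) i1 i2 sn => [|k] //= i1 i2 sn -> ->.
have := bA 1%N ltac:(lia).
by rewrite exprS -signr_odd; case: (odd j) => -[->|->]; rewrite /=; lia.
Qed.

Lemma jump_eq0 {n m : nat} {A : n.-tuple int} {s : nat -> nat} {i : nat} :
  run_ends A m s -> (i < n)%N -> (forall j, (j < m)%N -> i != s j) ->
  jump (fun i => entry A i.+1) i = 0.
Proof.
move=> [s0 sm si sv] lt ns.
have : (i < s m)%N by rewrite sm.
elim: m si sv {sm} ns => [|k IH] si sv ns; first by rewrite s0.
have [lt_ik _|le_ki ik] := ltnP i (s k).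
  apply: IH => //.
  - by move=> j jk; apply: si; lia.
  - by move=> j l jk; apply: sv; lia.
  - by move=> j jk; apply: ns; lia.
have := ns k (ltnSn k).
case: i lt ik le_ki ns {IH} => [|i] //= lt ik le_ki ns ne.
  by have := ns 0%N isT; rewrite s0.
by rewrite (sv k i.+2) 1?(sv k i.+1) ?subrr //; lia.
Qed.

(** * The bound *)

Theorem lemma4 (n m : nat) (A : n.-tuple int) (s : nat -> nat) (e : nat) :
  (1 < n)%N -> n = (2 * m - 1)%N -> barker A -> run_ends A m s ->
  (1 < s 1)%N -> first_nondiv m s e ->
  (n <= s 1 + s e + 1)%N.
Proof.
move=> n1 nm BA RE s1 [em nd_e dv_e]; rewrite leqNgt; apply/negP => n_big.
have [[_ bA _] [s0 sm si _]] := (BA, RE).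
have n_odd : odd n by lia.
set p := s 1%N in s1 nd_e dv_e n_big *; set q := s e in nd_e n_big *.
pose b := jump (fun i => entry A i.+1).
have e_lt : (e < m)%N.
  rewrite ltn_neqAle; case: eqVneq => [E|_] /=; last by lia.
  by move: n_big; rewrite /q E sm; lia.
have e_gt1 : (1 < e)%N.
  rewrite ltn_neqAle; case: eqVneq => [E|_] /=; last by lia.
  by move: nd_e; rewrite /q -E dvdnn.
have conv0 := barker_altconv_jump BA n_odd; rewrite -/b in conv0.
have b_dvd i : (i < q)%N -> ~~ (p %| i)%N -> b i = 0.
  move=> iq nd; apply: (jump_eq0 RE); first by lia.
  move=> j jm; apply/eqP => E; move: nd iq; rewrite E.
  have [->|j0] := posnP j; first by rewrite s0 dvdn0.
  have [je|ej] := ltnP j e; first by rewrite dv_e // j0.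
  move: ej; rewrite leq_eqVlt => /orP[/eqP <-|ej]; first by rewrite ltnn.
  by have := run_ends_lt (i := e) (j := j) RE ltac:(lia); rewrite /q; lia.
have b0 : `|b 0%N| = 1 by rewrite /b /=; case: (bA 1%N ltac:(lia)) => ->.
have bp : `|b p| = 2 by apply: (jump_neq0 (j := 1) RE bA); lia.
have bq : `|b q| = 2 by apply: (jump_neq0 (j := e) RE bA); lia.
have pq : (p < q)%N by apply: (run_ends_lt RE); lia.
have mul0 i j : (i < q)%N -> (j < q)%N -> ~~ (p %| i + j)%N -> b i * b j = 0.
  move=> iq jq nd; case: (boolP (p %| i)%N) => [di|/b_dvd -> //].
    by rewrite [b j]b_dvd ?mulr0 // -(dvdn_addr j di).
  by rewrite mul0r.
have p_odd : odd p.
  apply/negPn/negP => p_even; have := conv0 p p_even ltac:(lia) ltac:(lia).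
  rewrite altconv_even_ends //; [nia|lia|move=> i ip].
  by rewrite b_dvd ?mul0r ?gtnNdvd //; lia.
have q_odd : odd q.
  apply/negPn/negP => q_even; have := conv0 q q_even ltac:(lia) ltac:(lia).
  rewrite altconv_even_ends //; [nia|lia|move=> i iq].
  by rewrite mul0 ?subnKC //; lia.
have := conv0 (p + q)%N ltac:(lia) ltac:(lia) ltac:(lia).
rewrite altconv_even_ends_pair //; [|lia|]; last first.
  move=> i ipq ip iq; have [lt|ge] := ltnP i p.
    by rewrite b_dvd ?mul0r ?gtnNdvd //; lia.
  have [lt|ge'] := ltnP q i.
    by rewrite [b (_ - _)%N]b_dvd ?mulr0 ?gtnNdvd //; lia.
  by rewrite mul0 ?subnKC ?dvdn_addr //; lia.
(* It remains to see that b (p + q) is too small to make up for b p * b q. *)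
have := bA (p + q)%N ltac:(lia); have := bA (p + q).+1 ltac:(lia).
have -> : b (p + q)%N = entry A (p + q).+1 - entry A (p + q)%N.
  have : (0 < p + q)%N by lia.
  by rewrite /b; case: (p + q)%N.
move: (entry A _) (entry A _) => x y.
clear -b0 bp bq; nia.
Qed.
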